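(* There exists exactly one function $F:]-1,\infty[\to]0,\infty[$ with the properties (i) $F(0)=1$; (ii) $F$ is log-convex; (iii) $1/F(s)=1/F(s+1)-F(s+1)$ for all $s>-1$; namely $F(s)=\int_0^1 t^s\,d\mu(t)$ for $s>-1$ (this integral being finite for $s>-1$).
   Context: Let $(m_n)_{n\ge0}$ be the unique sequence of positive reals with $m_0=1$ and $(1+m_1+\cdots+m_n)\,m_n=1$ for $n\ge1$. It is a Hausdorff moment sequence: let $\mu$ be the unique probability measure on $[0,1]$ with $\int_0^1 t^n\,d\mu(t)=m_n$ for all $n\ge0$; it has no mass at $0$. *)

(* Defs.v *)
From HB Require Import structures.
From mathcomp Require Import all_boot all_order all_algebra.
From mathcomp Require Import all_classical all_reals all_analysis.
Set Implicit Arguments. Unset Strict Implicit. Unset Printing Implicit Defensive.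
Import Order.TTheory GRing.Theory Num.Theory.
Local Open Scope classical_set_scope.
Local Open Scope ring_scope.

Definition log_convex_on (R : realType) (D : set R) (F : R -> R) : Prop :=
  forall x y t : R, D x -> D y -> 0 <= t <= 1 ->
    ln (F ((1 - t) * x + t * y)) <= (1 - t) * ln (F x) + t * ln (F y).

(* Properties (i)-(iii) of Theorem 1.3 for F : ]-1,oo[ -> ]0,oo[
   (F is given as a total function R -> R; only its values on ]-1,oo[ matter). *)
Definition thm_props (R : realType) (F : R -> R) : Prop :=
  [/\ (forall s : R, -1 < s -> 0 < F s),
      F 0 = 1,
      log_convex_on `]-1, +oo[%classic F &
      (forall s : R, -1 < s -> 1 / F s = 1 / F (s + 1) - F (s + 1))].

(* Main.v *)
Require Import Defs.
From HB Require Import structures.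
From mathcomp Require Import all_boot all_order all_algebra.
From mathcomp Require Import all_classical all_reals all_analysis.
From mathcomp Require Import measurable_realfun.
From mathcomp Require Import ring lra.
Import Order.TTheory GRing.Theory Num.Theory.
Import numFieldNormedType.Exports.
Local Open Scope classical_set_scope.
Local Open Scope ring_scope.

(* Existence. Put h_s(u) = (1 - u^(s+1))/(1-u).  The recursion of the moments says
   that int t^k dmu(t) * int h_k(u) dmu(u) = 1 for every natural k, that is, the
   double integral of [p(t) - u p(tu)]/(1-u) is p(1) for every polynomial p.
   For p = x^n (1 - (1-x)^j)/x this kernel is nonnegative on the unit square, since
   x p(x) is increasing; comparing with the value p(0) = j for n = 0 excludes an atom
   of mu at 0.  With s + 1 = n + a and 0 < a <= 1, the binomial series writes x^s as a
   convex combination of these p, so Tonelli's theorem gives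
   int t^s dmu(t) * int h_s(u) dmu(u) = 1 for all real s > -1.  Hence the first integral
   F(s) is finite, and h_(s+1)(u) - h_s(u) = u^(s+1) yields (iii).

   Uniqueness. Let y = 1/F, so that y(s) = y(s+1) - 1/y(s+1).  Two solutions agree at
   the naturals, and log-convexity forces their y's at n+s to differ by
   O(F(n)^3) = O(n^(-3/2)) for 0 < s <= 1.  Since y(s+n)^2 >= n, going back from n+s to
   s amplifies the difference at most by the product of the 1 + 1/k, that is n + 1. *)

(** * Archimedean, convexity and extended-real preliminaries *)

Section preliminaries.
Variable R : realType.

Lemma le0_bounded_multiples (v : R) : (forall n, n.+1%:R * v <= 1) -> v <= 0.
Proof.
move=> H; rewrite leNgt; apply/negP => v0.
have := H (Num.bound v^-1); apply/negP; rewrite -ltNge -ltr_pdivrMr// div1r.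
apply: (@lt_le_trans _ _ (Num.bound v^-1)%:R); last by rewrite ler_nat.
by rewrite archi_boundP// invr_ge0 ltW.
Qed.

(** The fractional part is taken in []0, 1]] rather than [[0, 1[] because the binomial series below
    needs a positive exponent. *)
Lemma split_exponent (x : R) : 0 < x ->
  exists n a, [/\ 0 < a, a <= 1 & x = n%:R + a].
Proof.
move=> x0; have ex : exists n, x <= n.+1%:R.
  exists (Num.bound x); apply: (@le_trans _ _ (Num.bound x)%:R).
    by rewrite ltW// archi_boundP// ltW.
  by rewrite ler_nat.
case: (ex_minnP ex) => -[|n] xn nmin.
  by exists 0, x; rewrite add0r.
exists n.+1, (x - n.+1%:R); split; last by rewrite addrC subrK.
- by rewrite subr_gt0 ltNge; apply/negP => /nmin; rewrite ltnn.
- by rewrite lerBlDr addrC natr1.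
Qed.

Lemma nneseries_EFin (f : nat -> R) (l : R) :
  (\sum_(j < N) f j) @[N --> \oo] --> l -> (\sum_(j <oo) (f j)%:E = l%:E)%E.
Proof.
move=> fl; apply: cvg_lim => //.
rewrite (_ : (fun n => _) = EFin \o (fun N => \sum_(j < N) f j)); last first.
  by apply/funext => n /=; rewrite big_mkord sumEFin.
exact: (cvg_comp _ _ fl).
Qed.

Lemma expR_convex (p q th : R) : 0 <= th <= 1 ->
  expR ((1 - th) * p + th * q) <= (1 - th) * expR p + th * expR q.
Proof.
move=> /andP[th0 th1].
have tangent (r x : R) : expR r * (1 + (x - r)) <= expR x.
  have -> : expR x = expR r * expR (x - r) by rewrite -expRD subrKC.
  by rewrite ler_wpM2l ?expR_ge0// expR_ge1Dx.
set r := _ + th * q.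
(* The tangent at [r], evaluated at [p] and [q] and averaged, returns [expR r]. *)
rewrite (_ : expR r = (1 - th) * (expR r * (1 + (p - r))) +
   th * (expR r * (1 + (q - r)))); last by rewrite /r; ring.
by rewrite lerD// ler_wpM2l ?subr_ge0.
Qed.

(** Young's inequality for [t^x / A] and [t^y / B]. When [A] and [B] are the integrals of [t^x] and
    [t^y], integrating it turns the right side into [expR L], which is Hoelder's inequality. *)
Lemma powR_log_convex (t x y th A B : R) : 0 < t -> 0 < A -> 0 < B ->
  0 <= th <= 1 -> forall L, L = (1 - th) * ln A + th * ln B ->
  t `^ ((1 - th) * x + th * y) <=
  expR L * (1 - th) / A * t `^ x + expR L * th / B * t `^ y.
Proof.
move=> t0 A0 B0 th01 L LE.
have pE w : t `^ w = expR (w * ln t) by rewrite /powR gt_eqF.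
have h := expR_convex (x * ln t - ln A) (y * ln t - ln B) th th01.
rewrite !pE; move: h; rewrite !expRB !lnK ?posrE// => h.
have -> : ((1 - th) * x + th * y) * ln t =
    L + ((1 - th) * (x * ln t - ln A) + th * (y * ln t - ln B)).
  by rewrite LE; ring.
rewrite expRD; apply: (le_trans (ler_wpM2l (expR_ge0 L) h)).
rewrite mulrDr [leLHS](_ : _ = expR L * (1 - th) / A * expR (x * ln t) +
  expR L * th / B * expR (y * ln t))// !mulrA.
by congr (_ + _); rewrite mulrAC.
Qed.

(** An infinite factor would make the product 0 or infinite, since [0 * oo = 0]. This is the source
    of the finiteness of the Mellin transform. *)
Lemma mule_eq1 (x y : \bar R) : (0 <= x -> 0 <= y -> x * y = 1 ->
  exists2 r : R, (0 < r)%R & x = r%:E /\ y = r^-1%:E)%E.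
Proof.
have ne01 : (0 : \bar R) <> 1%E by move=> [] /eqP; rewrite eq_sym oner_eq0.
case: x => [x| |]//; case: y => [y| |]//; rewrite ?lee_fin.
- move=> x0 y0 xy; have x1 : 0 < x.
    rewrite lt_neqAle x0 andbT; apply/eqP => xE.
    by move: xy; rewrite -xE mul0e => /ne01.
  exists x => //; split => //; congr (_%:E); case: xy => xy.
  by apply: (mulfI (lt0r_neq0 x1)); rewrite xy divff// lt0r_neq0.
- rewrite le_eqVlt => /predU1P[<-|x0] _; first by rewrite mul0e => /ne01.
  by rewrite gt0_muley ?lte_fin.
- move=> _; rewrite le_eqVlt => /predU1P[<-|y0]; first by rewrite mule0 => /ne01.
  by rewrite gt0_mulye ?lte_fin.
Qed.
End preliminaries.

(** * The binomial series *)

Section binomial_series.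
Variables (R : realType) (a : R).
Hypotheses (a0 : 0 < a) (a1 : a <= 1).

(* [pow_coef j] is (-1)^j binom(a, j+1), the coefficient in
   [x^a = sum_j pow_coef j * (1 - (1 - x)^(j+1))]. *)
Fixpoint pow_coef (j : nat) : R :=
  if j is i.+1 then pow_coef i * (i.+1%:R - a) / i.+2%:R else a.

Lemma pow_coef_ge0 j : 0 <= pow_coef j.
Proof.
elim: j => [|j ih] /=; first exact: ltW.
rewrite divr_ge0// mulr_ge0// subr_ge0 (le_trans a1)//.
by rewrite -[1]/(1%:R) ler_nat.
Qed.

(** With [c_j = pow_coef j], the recurrence reads [(j+2) c_(j+1) = (j+1-a) c_j], so the products
    [(j+1) c_j] never increase. *)
Lemma pow_coef_le j : j.+1%:R * pow_coef j <= a.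
Proof.
elim: j => [|j ih] /=; first by rewrite mul1r.
rewrite mulrC divfK ?pnatr_eq0//; apply: le_trans ih.
by rewrite mulrC ler_wpM2r ?pow_coef_ge0// gerBl ltW.
Qed.

(** Truncation of the binomial series of [(1 - y)^a]. *)
Definition pow_poly (N : nat) : {poly R} :=
  1 - \sum_(j < N) pow_coef j *: 'X^(j.+1).

Lemma pow_polyE N (y : R) :
  (pow_poly N).[y] = 1 - \sum_(j < N) pow_coef j * y ^+ j.+1.
Proof.
rewrite /pow_poly !hornerE horner_sum; congr (_ - _).
by apply: eq_bigr => i _; rewrite !hornerE.
Qed.

(** The function [(1 - y)^a] solves [(1 - y) f' + a f = 0]; truncating its series leaves only the
    top-degree term as defect. *)
Lemma pow_poly_ode N (y : R) :
  (1 - y) * (pow_poly N)^`().[y] + a * (pow_poly N).[y]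
  = N.+1%:R * pow_coef N * y ^+ N.
Proof.
elim: N => [|N ih].
  rewrite /pow_poly big_ord0 subr0 -polyC1 derivC !hornerE /=; ring.
have -> : pow_poly N.+1 = pow_poly N - pow_coef N *: 'X^(N.+1).
  by rewrite /pow_poly big_ord_recr/= opprD addrA.
move: (pow_poly N) ih => p ih.
have -> : N.+2%:R * pow_coef N.+1 = pow_coef N * (N.+1%:R - a).
  by rewrite /= mulrC divfK ?pnatr_eq0.
rewrite derivB derivZ derivXn !hornerE hornerMn !hornerE /=.
rewrite -mulr_natl exprS.
rewrite [a * (_ - _)]mulrBr.
have -> : a * p.[y] = N.+1%:R * pow_coef N * y ^+ N - (1 - y) * p^`().[y].
  by rewrite -ih; ring.
ring.
Qed.

(* The quotient of the truncated series by [(1 - y)^a] equals 1 at 0, and by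
   [pow_poly_ode] its derivative is a single nonnegative term. *)
Lemma pow_poly_bound N (y : R) : 0 < y < 1 ->
  0 <= (pow_poly N).[y] - (1 - y) `^ a <= y ^+ N / (1 - y).
Proof.
move=> /andP[y0 y1].
have pos (c : R) : c \in `]0, y[ -> 0 < 1 - c.
  by rewrite in_itv/= => /andP[_ cy]; rewrite subr_gt0 (lt_trans cy).
pose h := (fun z : R => (pow_poly N).[z] * (1 - z) `^ (- a)).
have dh (c : R) : c < 1 -> is_derive c (1 : R) h
    (N.+1%:R * pow_coef N * c ^+ N * (1 - c) `^ (- a - 1)).
  move=> c1.
  have d1 : is_derive c (1 : R) (fun z : R => (pow_poly N).[z]) (pow_poly N)^`().[c].
    by rewrite derivE derive1E; apply: DeriveDef => //; exact: derivable_horner.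
  have c1' : 0 < 1 - c by rewrite subr_gt0.
  have d2 : is_derive c (1 : R) (fun z : R => (1 - z) `^ (- a))
      (a * (1 - c) `^ (- a - 1)).
    have := is_derive1_powR (- a) c1'.
    move=> d.
    have d3 : is_derive c (1 : R) (fun z : R => 1 - z) (- 1).
      apply: is_derive_eq; ring.
    have := @is_derive1_comp R (fun z : R => z `^ (- a)) (fun z : R => 1 - z) c _ _ d d3.
    move=> H; rewrite (_ : a * _ = - a * (1 - c) `^ (- a - 1) * -1); last by ring.
    exact: H.
  have -> : h = (fun z : R => (pow_poly N).[z]) * (fun z : R => (1 - z) `^ (- a)).
    exact/funext.
  apply: (@is_derive_eq _ _ _ _ _ _ _ _ (is_deriveM d1 d2)).
  rewrite -pow_poly_ode.
  rewrite (_ : (1 - c) `^ (- a) = (1 - c) * (1 - c) `^ (- a - 1)); last first.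
    rewrite -[X in X * _]powRr1 ?ltW// -powRD ?lt0r_neq0 ?implybT//.
    by congr (_ `^ _); ring.
  rewrite /GRing.scale/=; ring.
have [|||c cI] := @MVT R h (fun c : R =>
  N.+1%:R * pow_coef N * c ^+ N * (1 - c) `^ (- a - 1)) 0 y.
- exact: y0.
- by move=> x /pos; rewrite subr_gt0; exact: dh.
- apply: continuous_in_subspaceT => x.
  rewrite inE/= in_itv/= => /andP[x0 xy].
  have [dx _] := dh x (le_lt_trans xy y1).
  exact/differentiable_continuous/derivable1_diffP.

rewrite !subr0 /h; move=> hE.
have {}hE : (pow_poly N).[y] - (1 - y) `^ a =
    (1 - y) `^ a * (N.+1%:R * pow_coef N * c ^+ N * (1 - c) `^ (- a - 1) * y).
  rewrite -hE subr0 powR1 mulr1 mulrBr mulrCA -powRD; last first.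
    by rewrite (lt0r_neq0) ?subr_gt0// implybT.
  rewrite subrr powRr0 mulr1 (_ : (pow_poly N).[0] = 1) ?mulr1//.
  rewrite pow_polyE big1 ?subr0// => i _; by rewrite expr0n mulr0.
have cpos := pos _ cI; have ypos : 0 < 1 - y by rewrite subr_gt0.
move: cI; rewrite in_itv/= => /andP[c0 cy].
have [c0' y0'] := (ltW c0, ltW y0); have [cpos' ypos'] := (ltW cpos, ltW ypos).
have dN : 0 <= N.+1%:R * pow_coef N by rewrite mulr_ge0 ?pow_coef_ge0.
have dN1 : N.+1%:R * pow_coef N <= 1 by exact: le_trans (pow_coef_le _) a1.
have powcN : 0 <= N.+1%:R * pow_coef N * c ^+ N by rewrite mulr_ge0 ?exprn_ge0.
rewrite hE; apply/andP; split.
  by rewrite !mulr_ge0 ?powR_ge0 ?pow_coef_ge0 ?exprn_ge0.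
(* Each factor is now bounded using [c < y < 1]: the coefficient by 1, [c^N] by [y^N],
   [(1-c)^(-a-1)] by [(1-y)^(-a-1)] and the last [y] by 1. The powers of [1 - y] combine to its
   inverse. *)
rewrite [leRHS](_ : _ = (1 - y) `^ a * (1 * y ^+ N * (1 - y) `^ (- a - 1) * 1)); last first.
  rewrite mulr1 mul1r mulrCA -powRD; last by rewrite lt0r_neq0// implybT.
  by rewrite addrA subrr sub0r powR_inv1.
rewrite ler_wpM2l ?powR_ge0// ler_pM ?(mulr_ge0 powcN) ?powR_ge0//; last exact: ltW.
rewrite ler_pM ?powR_ge0//.
  by rewrite ler_pM ?exprn_ge0// lerXn2r ?nnegrE// ltW.
rewrite -opprD !powRN lef_pV2 ?posrE ?powR_gt0//.
rewrite ge0_ler_powR ?nnegrE//; first by rewrite addr_ge0// ltW.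
by rewrite lerD2l lerN2 ltW.
Qed.

(** [pow_poly_bound] stops short of [y = 1]. At [y = 1 - z] it bounds the gap between 1 and the
    partial sum by [z^a + (1-z)^N / z]; [z] is fixed first, with [z^a <= e / 2], and then [N]
    grows. *)
Lemma pow_coef_sum_cvg : (\sum_(j < N) pow_coef j) @[N --> \oo] --> (1 : R).
Proof.
apply/cvgrPdist_le => /= e e0.
pose b := Num.min (e / 2) (1 / 2).
have b0 : 0 < b by rewrite lt_min !divr_gt0.
have be : b <= e / 2 by rewrite ge_min lexx.
have b1 : b < 1 by rewrite (@le_lt_trans _ _ (1 / 2)) ?ge_min ?lexx ?orbT//; lra.
pose z := b `^ a^-1.
have z0 : 0 < z by rewrite powR_gt0.
have z1 : z < 1.
  by rewrite -[ltRHS](congr1 (@^~ a^-1) (powR1 R)) gt0_ltr_powR ?invr_gt0 ?nnegrE// ltW.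
have za : z `^ a = b by rewrite -powRrM mulVf ?lt0r_neq0// powRr1// ltW.
have /cvgrPdist_le/(_ (e / 2 * z)) : (1 - z) ^+ N @[N --> \oo] --> (0 : R).
  by apply: cvg_expr; rewrite ger0_norm; lra.
rewrite mulr_gt0 ?divr_gt0// => /(_ isT); apply: filterS => N.
rewrite sub0r normrN => yN.
have /(pow_poly_bound N) : 0 < 1 - z < 1 by lra.
rewrite subKr za => /andP[_].
have hN : (1 - z) ^+ N / z <= e / 2.
  by rewrite ler_pdivrMr//; apply: le_trans yN; exact: ler_norm.
move=> /le_trans/(_ hN); rewrite pow_polyE.
have le1 : \sum_(j < N) pow_coef j * (1 - z) ^+ j.+1 <= \sum_(j < N) pow_coef j.
  apply: ler_sum => j _; rewrite ler_piMr ?pow_coef_ge0// exprn_ile1//; lra.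
have le2 : \sum_(j < N) pow_coef j <= 1.
  (* At [y = 1] the differential equation reduces to [a (1 - sum) = (N+1) c_N >= 0]. *)
  have := pow_poly_ode N 1; rewrite subrr mul0r add0r expr1n mulr1 pow_polyE.
  under eq_bigr do rewrite expr1n mulr1.
  by rewrite -subr_ge0 -(pmulr_rge0 _ a0) => ->; rewrite mulr_ge0 ?pow_coef_ge0.
by move=> h; rewrite ger0_norm; lra.
Qed.

Lemma pow_series_cvg (x : R) : 0 < x <= 1 ->
  (\sum_(j < N) pow_coef j * (1 - (1 - x) ^+ j.+1)) @[N --> \oo] --> x `^ a.
Proof.
move=> /andP[x0]; rewrite le_eqVlt => /orP[/eqP->|x1].
  rewrite powR1; under eq_fun do under eq_bigr do rewrite subrr expr0n subr0 mulr1.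
  exact: pow_coef_sum_cvg.
have cy : (1 - x) ^+ N / x @[N --> \oo] --> (0 : R).
  rewrite -[X in _ --> X](mul0r x^-1); apply: cvgMl.
  by apply: cvg_expr; rewrite ger0_norm; lra.
have cp : (pow_poly N).[1 - x] - x `^ a @[N --> \oo] --> (0 : R).
  apply: (@squeeze_cvgr _ _ _ _ (fun=> 0) (fun N => (1 - x) ^+ N / x)) => //.
    apply: nearW => N; have /(pow_poly_bound N) : 0 < 1 - x < 1 by lra.
    by rewrite subKr.
  exact: cvg_cst.
rewrite [X in _ --> X](_ : _ = 1 - 1 + (0 + x `^ a)); last by ring.
rewrite (_ : (fun _ => _) = (fun N => \sum_(j < N) pow_coef j - 1 +
  ((pow_poly N).[1 - x] - x `^ a + x `^ a))); last first.
  apply/funext => N; rewrite pow_polyE.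
  under eq_bigr do rewrite mulrBr mulr1.
  by rewrite sumrB; ring.
apply: cvgD; last by apply: cvgD => //; exact: cvg_cst.
by apply: cvgB; [exact: pow_coef_sum_cvg|exact: cvg_cst].
Qed.
End binomial_series.

(** * Uniqueness *)

Section uniqueness.
Variable R : realType.
Implicit Types (F G : R -> R) (s x y : R).

Lemma ltN1n (n : nat) : -1 < n%:R :> R.
Proof. exact: lt_le_trans (ltrN10 R) (ler0n R n). Qed.

(** Lets (iii) be run forward, from [s] to [s + 1]: the map [x -> 1/x - x] is strictly decreasing on
    positive reals. *)
Lemma sub_inv_inj x y : 0 < x -> 0 < y -> 1 / x - x = 1 / y - y -> x = y.
Proof.
move=> x0 y0 /eqP; rewrite -subr_eq0.
have -> : 1 / x - x - (1 / y - y) = (y - x) * (1 / (x * y) + 1).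
  by field; rewrite !lt0r_neq0.
rewrite mulf_eq0 => /orP[|/eqP h]; first by rewrite subr_eq0 => /eqP.
have : 0 < 1 / (x * y) + 1 by rewrite addr_gt0// divr_gt0// mulr_gt0.
by rewrite h ltxx.
Qed.

Lemma inv_shift F s : thm_props F -> -1 < s ->
  (F s)^-1 = (F (s + 1))^-1 - ((F (s + 1))^-1)^-1.
Proof. by case=> _ _ _ H /H; rewrite !div1r invrK. Qed.

(** Squaring gives [x^2 = y^2 - 2 + y^-2], and [x > 0] forces [y^-1 < y], hence [y^-2 < 1]. *)
Lemma inv_sqr_step (x y : R) : 0 < x -> 0 < y -> x = y - y^-1 ->
  x ^+ 2 + 1 <= y ^+ 2.
Proof.
move=> x0 y0 xE.
have yy : y * y^-1 = 1 by rewrite divff// lt0r_neq0.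
have v0 : 0 < y^-1 by rewrite invr_gt0.
have vy : y^-1 < y by rewrite -subr_gt0 -xE.
move: (y^-1) xE yy v0 vy => v -> yy v0 vy; nra.
Qed.

Lemma inv_sqr_ge F s n : thm_props F -> -1 < s ->
  n%:R <= (F (s + n%:R))^-1 ^+ 2.
Proof.
move=> HF s1; elim: n => [|n ih]; first by rewrite sqr_ge0.
have [Fpos _ _ _] := HF.
have sn : -1 < s + n%:R by rewrite ltr_wpDr.
have sn1 : -1 < s + n%:R + 1 by rewrite ltr_wpDr.
have e : s + n.+1%:R = s + n%:R + 1 by rewrite -addrA natr1.
rewrite e -natr1; apply: (le_trans _ (inv_sqr_step _ _ _ _ (inv_shift _ _ HF sn)));
  by rewrite ?lerD2r ?invr_gt0 ?Fpos.
Qed.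

Lemma inv_dist_le F G s n : thm_props F -> thm_props G -> -1 < s ->
  `|(F s)^-1 - (G s)^-1| <=
  n.+1%:R * `|(F (s + n%:R))^-1 - (G (s + n%:R))^-1|.
Proof.
move=> HF HG s1; elim: n => [|n ih]; first by rewrite addr0 mul1r.
apply: (le_trans ih).
have sn : -1 < s + n%:R by rewrite ltr_wpDr.
have sn1 : -1 < s + n.+1%:R by rewrite ltr_wpDr.
have e : s + n%:R + 1 = s + n.+1%:R by rewrite -addrA natr1.
have [Fpos _ _ _] := HF; have [Gpos _ _ _] := HG.
rewrite (inv_shift _ _ HF sn) (inv_shift _ _ HG sn) e.
have := inv_sqr_ge _ _ n.+1 HF s1; have := inv_sqr_ge _ _ n.+1 HG s1.
have : 0 < (F (s + n.+1%:R))^-1 by rewrite invr_gt0 Fpos.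
have : 0 < (G (s + n.+1%:R))^-1 by rewrite invr_gt0 Gpos.
move: ((F (s + n.+1%:R))^-1) ((G (s + n.+1%:R))^-1) => x y y0 x0 y2 x2.
have xy : n.+1%:R <= x * y.
  have [/ltW x0' /ltW y0'] := (x0, y0).
  rewrite -ler_sqr ?nnegrE ?mulr_ge0//.
  by rewrite exprMn [leLHS]expr2 ler_pM.
(* One step back multiplies the difference by [1 + 1/(xy)], at most [(n+2)/(n+1)]; this turns the
   factor [n+1] into [n+2]. *)
have -> : x - x^-1 - (y - y^-1) = (x - y) * (1 + (x * y)^-1).
  by field; rewrite !lt0r_neq0.
rewrite normrM mulrCA mulrC ler_wpM2r// ger0_norm; last first.
  by rewrite addr_ge0// invr_ge0 mulr_ge0 ?ltW.
rewrite mulrDr mulr1 -[leRHS]natr1 lerD2l ler_pdivrMr ?mulr_gt0//.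
by rewrite mul1r.
Qed.

Lemma thm_props_nat F G n : thm_props F -> thm_props G ->
  F n%:R = G n%:R.
Proof.
move=> [Fp F0 _ Fr] [Gp G0 _ Gr]; elim: n => [|n ih]; first by rewrite F0 G0.
have n1 : -1 < n%:R :> R by rewrite (@lt_le_trans _ _ 0).
have n2 : -1 < n%:R + 1 :> R by rewrite ltr_wpDr.
rewrite -natr1; apply: sub_inv_inj; rewrite ?Fp ?Gp//.
by rewrite -Fr// -Gr// ih.
Qed.

Lemma ln_upper F s n : thm_props F -> 0 < s <= 1 ->
  ln (F (n%:R + s)) <= (1 - s) * ln (F n%:R) + s * ln (F n.+1%:R).
Proof.
move=> [_ _ HL _] /andP[s0 s1].
have -> : n%:R + s = (1 - s) * n%:R + s * n.+1%:R by rewrite -natr1; ring.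
by apply: HL; rewrite /= ?in_itv/= ?andbT ?ltN1n// s1 ltW.
Qed.

(** Here [n+1] is the intermediate point: it divides the segment from [n] to [n+1+s] with weight
    [1/(1+s)] on the right end. *)
Lemma ln_lower F s n : thm_props F -> 0 < s <= 1 ->
  (1 + s) * ln (F n.+1%:R) - s * ln (F n%:R) <= ln (F (n.+1%:R + s)).
Proof.
move=> [_ _ HL _] /andP[s0 s1].
have s2 : 0 < 1 + s by rewrite addr_gt0.
have h : ln (F n.+1%:R) <= s / (1 + s) * ln (F n%:R) + (1 + s)^-1 * ln (F (n.+1%:R + s)).
  have -> : s / (1 + s) = 1 - (1 + s)^-1 by field; rewrite lt0r_neq0.
  have {1}-> : n.+1%:R = (1 - (1 + s)^-1) * n%:R + (1 + s)^-1 * (n.+1%:R + s).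
    by rewrite -natr1; field; rewrite lt0r_neq0.
  apply: HL; rewrite /= ?in_itv/= ?andbT.
  - exact: ltN1n.
  - by rewrite ltr_wpDr ?ltN1n// ltW.
  - by rewrite invr_ge0 ltW//= invf_le1// lerDl ltW.
have := ler_wpM2l (ltW s2) h.
have -> : (1 + s) * (s / (1 + s) * ln (F n%:R) + (1 + s)^-1 * ln (F (n.+1%:R + s)))
  = s * ln (F n%:R) + ln (F (n.+1%:R + s)) by field; rewrite lt0r_neq0.
by move=> {}h; lra.
Qed.

(* With A, B, C the common values at n, n+1, n+2, log-convexity traps F(n+1+s)
   and G(n+1+s) within a ratio AC/B^2, and AC/B^2 - 1 = (B^2-C^2)/(1-B^2). *)
Lemma inv_dist_nat F G s n : thm_props F -> thm_props G -> 0 < s <= 1 ->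
  (G (n.+1%:R + s))^-1 - (F (n.+1%:R + s))^-1 <= 8 * F n.+1%:R ^+ 3.
Proof.
move=> HF HG s01; have /andP[s0 s1] := s01.
have [Fpos F0 _ Fr] := HF; have [Gpos G0 _ Gr] := HG.
have nat1 := ltN1n.
have u1 := ln_upper _ _ n.+1 HF s01; have l1 := ln_lower _ _ n HF s01.
have l2 := ln_lower _ _ n HG s01.
rewrite -!(thm_props_nat _ _ _ HF HG) in l2.
have p1 : 0 < F (n.+1%:R + s) by rewrite Fpos// ltr_wpDr// ltW.
have p2 : 0 < G (n.+1%:R + s) by rewrite Gpos// ltr_wpDr// ltW.
have A0 := Fpos _ (nat1 n); have B0 := Fpos _ (nat1 n.+1); have C0 := Fpos _ (nat1 n.+2).
have rA : (F n%:R)^-1 = (F n.+1%:R)^-1 - F n.+1%:R.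
  by have := Fr _ (nat1 n); rewrite !div1r natr1.
have rB : (F n.+1%:R)^-1 = (F n.+2%:R)^-1 - F n.+2%:R.
  by have := Fr _ (nat1 n.+1); rewrite !div1r natr1.
(* This keeps [1 - B^2] at least [1/2]. Starting from [1 / F 0 = 1], the induction gains one over
   [inv_sqr_ge]. *)
have B2 : F n.+1%:R ^+ 2 <= 1 / 2.
  have : n.+1%:R + 1 <= (F n.+1%:R)^-1 ^+ 2.
    elim: (n) {u1 l1 l2 p1 p2 A0 B0 C0 rA rB} => [|k ih].
      apply: le_trans (inv_sqr_step 1 _ _ _ _); rewrite ?invr_gt0 ?Fpos//.
        by rewrite expr1n.
      by have := inv_shift _ _ HF (ltrN10 R); rewrite F0 invr1 add0r.
    rewrite -natr1 (le_trans _ (inv_sqr_step (F k.+1%:R)^-1 _ _ _ _))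
      ?invr_gt0 ?Fpos ?lerD2r//.
      by rewrite ltr_wpDr.
    exact: (inv_shift _ _ HF (nat1 k.+1)).
  rewrite exprVn => h.
  rewrite -[leLHS]invrK div1r lef_pV2 ?posrE ?invr_gt0 ?exprn_gt0//.
  by rewrite (le_trans _ h)// natr1 ler_nat.
move: u1 l1 l2 p1 p2 A0 B0 C0 rA rB B2.
move: (F n%:R) (F n.+1%:R) (F n.+2%:R) (F (n.+1%:R + s)) (G (n.+1%:R + s)).
move=> A B C f g u1 l1 l2 f0 g0 A0 B0 C0 rA rB B2.
have CB : C <= B.
  have : C * B * B^-1 = C * B * (C^-1 - C) by rewrite -rB.
  have -> : C * B * B^-1 = C by field; rewrite lt0r_neq0.
  have -> : C * B * (C^-1 - C) = B - B * C ^+ 2 by field; rewrite lt0r_neq0.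
  by move=> ->; rewrite gerBl mulr_ge0 ?sqr_ge0 ?ltW.
have BA : B <= A.
  have : B * A * A^-1 = B * A * (B^-1 - B) by rewrite -rA.
  have -> : B * A * A^-1 = B by field; rewrite lt0r_neq0.
  have -> : B * A * (B^-1 - B) = A - A * B ^+ 2 by field; rewrite lt0r_neq0.
  by move=> ->; rewrite gerBl mulr_ge0 ?sqr_ge0 ?ltW.
have lBA : ln B <= ln A by rewrite ler_ln.
have v2 : f^-1 <= A / B ^+ 2.
  rewrite -ler_ln ?posrE ?invr_gt0 ?divr_gt0 ?exprn_gt0//.
  rewrite lnV// ln_div ?posrE ?exprn_gt0// lnXn//.
  have : s * (ln A - ln B) <= 1 * (ln A - ln B) by rewrite ler_wpM2r// subr_ge0.
  rewrite -mulr_natl; move: l1; nra.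
(* Obtained by comparing the upper and lower bounds of [ln f]. The sign allows the factor [s] to be
   replaced by 1 in the bound of [f / g]. *)
have E0 : 0 <= ln A + ln C - 2 * ln B.
  have h : 0 <= s * (ln A + ln C - 2 * ln B) by move: u1 l1; nra.
  by rewrite -(pmulr_rge0 _ s0).
have fg : f / g <= A * C / B ^+ 2.
  rewrite -ler_ln ?posrE ?divr_gt0 ?mulr_gt0 ?exprn_gt0//.
  rewrite !ln_div ?posrE ?mulr_gt0 ?exprn_gt0// lnM ?posrE// lnXn//.
  have : s * (ln A + ln C - 2 * ln B) <= 1 * (ln A + ln C - 2 * ln B).
    by rewrite ler_wpM2r.
  rewrite -mulr_natl; move: u1 l2; nra.
have BB : 0 < 1 - B ^+ 2 by lra.
have AE : A = B / (1 - B ^+ 2).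
  rewrite -[A]invrK rA; field.
  by rewrite !lt0r_neq0.
have CC : 0 < 1 - C ^+ 2.
  have : C ^+ 2 <= B ^+ 2 by rewrite lerXn2r ?nnegrE// ltW.
  by move=> h; lra.
have BC : B - C = B * C ^+ 2.
  have h : C * B * B^-1 = C * B * (C^-1 - C) by rewrite -rB.
  have h1 : C * B * B^-1 = C by field; rewrite lt0r_neq0.
  have h2 : C * B * (C^-1 - C) = B - B * C ^+ 2 by field; rewrite lt0r_neq0.
  rewrite h1 h2 in h.
  by rewrite {1}h; ring.
have BE : B ^+ 2 - C ^+ 2 <= 2 * B ^+ 4.
  have -> : B ^+ 2 - C ^+ 2 = (B * C ^+ 2) * (B + C) by rewrite -BC; ring.
  have -> : 2 * B ^+ 4 = (B * B ^+ 2) * (B + B) by ring.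
  rewrite ler_pM ?mulr_ge0 ?exprn_ge0 ?addr_ge0 ?lerD2l//; try exact: ltW.
  by rewrite ler_wpM2l ?lerXn2r ?nnegrE// ltW.
have AB2 : A <= 2 * B.
  rewrite AE ler_pdivrMr//; nra.
have rat : f / g - 1 <= 4 * B ^+ 4.
  have e : A * C / B ^+ 2 - 1 = (B ^+ 2 - C ^+ 2) / (1 - B ^+ 2).
    have CE : C / B = 1 - C ^+ 2.
      apply: (@mulIf _ B); first exact: lt0r_neq0.
      by rewrite divfK ?lt0r_neq0// mulrBl mul1r [C ^+ 2 * B]mulrC -BC subKr.
    rewrite AE (_ : _ / _ = (C / B) / (1 - B ^+ 2)); last first.
      by field; rewrite !lt0r_neq0.
    by rewrite CE; field; rewrite lt0r_neq0.
  apply: (@le_trans _ _ (A * C / B ^+ 2 - 1)); first by rewrite lerB.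
  rewrite e ler_pdivrMr//; nra.
(* The constant 8 is the product of [f^-1 <= 2 / B] and [f / g - 1 <= 4 B^4]. *)
have -> : g^-1 - f^-1 = f^-1 * (f / g - 1) by field; rewrite !lt0r_neq0.
have fi : f^-1 <= 2 / B.
  rewrite (le_trans v2)// ler_pdivrMr ?exprn_gt0//.
  by rewrite (_ : 2 / B * B ^+ 2 = 2 * B)//; field; rewrite lt0r_neq0.
apply: (@le_trans _ _ (f^-1 * (4 * B ^+ 4))).
  by rewrite ler_wpM2l// invr_ge0 ltW.
apply: (@le_trans _ _ (2 / B * (4 * B ^+ 4))).
  by rewrite ler_wpM2r// mulr_ge0// exprn_ge0// ltW.
by rewrite le_eqVlt; apply/orP; left; apply/eqP; field; rewrite lt0r_neq0.
Qed.

Lemma thm_props_unique01 F G s : thm_props F -> thm_props G -> 0 < s <= 1 ->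
  F s = G s.
Proof.
move=> HF HG s01; apply: invr_inj; apply/eqP; rewrite -subr_eq0 -normr_le0 leNgt.
apply/negP; set d := `|_| => d0.
have [Fpos _ _ _] := HF.
have /andP[s0 _] := s01.
have s1 : -1 < s by rewrite (lt_trans (ltrN10 R)).
(* With [B = F (n+1)] and [(n+1) B^2 <= 1], the bound [d <= (n+2) 8 B^3] yields [d <= 16 B]. Then
   [n e^2 <= (n+1) B^2 <= 1], against the choice of [n]. *)
pose e := d / 16.
have e0 : 0 < e by rewrite divr_gt0.
set n := Num.bound (e ^+ 2)^-1.
have : (e ^+ 2)^-1 < n%:R by rewrite archi_boundP// invr_ge0 sqr_ge0.
rewrite -div1r ltr_pdivrMr ?exprn_gt0//; apply/negP; rewrite -leNgt.
have hB : n.+1%:R * F n.+1%:R ^+ 2 <= 1.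
  have := inv_sqr_ge _ _ n.+1 HF (ltrN10 R); rewrite add0r exprVn => h.
  rewrite -[leRHS](@mulVf _ (F n.+1%:R ^+ 2)) ?expf_neq0 ?lt0r_neq0 ?Fpos ?ltN1n//.
  by rewrite ler_wpM2r ?sqr_ge0.
have B0 := Fpos _ (ltN1n n.+1).
have hd : d <= n.+2%:R * (8 * F n.+1%:R ^+ 3).
  apply: (le_trans (inv_dist_le _ _ _ n.+1 HF HG s1)).
  rewrite ler_wpM2l// [s + _]addrC ler_norml lerNl opprB.
  rewrite inv_dist_nat// (thm_props_nat _ _ n.+1 HF HG).
  by rewrite inv_dist_nat.
have {}hd : d <= 16 * F n.+1%:R.
  apply: (le_trans hd).
  have h2 : n.+2%:R <= 2 * n.+1%:R :> R
    by rewrite -[n.+2%:R]natr1 -[n.+1%:R]natr1; have := ler0n R n; lra.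
  have h3 : n.+2%:R * F n.+1%:R ^+ 2 <= 2.
    rewrite (@le_trans _ _ (2 * n.+1%:R * F n.+1%:R ^+ 2))//.
      by rewrite ler_wpM2r// sqr_ge0.
    by rewrite -mulrA -[leRHS]mulr1 ler_wpM2l.
  have -> : n.+2%:R * (8 * F n.+1%:R ^+ 3) = n.+2%:R * F n.+1%:R ^+ 2 * (8 * F n.+1%:R).
    by ring.
  have -> : 16 * F n.+1%:R = 2 * (8 * F n.+1%:R) by ring.
  by rewrite ler_wpM2r// mulr_ge0// ltW.
have eB : e <= F n.+1%:R by rewrite ler_pdivrMr// mulrC.
apply: le_trans hB; rewrite ler_pM ?sqr_ge0 ?ler_nat//.
by rewrite ler_sqr ?nnegrE ?(ltW e0) ?(ltW B0).
Qed.

(** Agreement on []0, 1]] spreads forward to all positive reals through [sub_inv_inj]; a single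
    backward step by (iii), from [s + 1] to [s], then reaches every [s > -1]. *)
Lemma thm_props_unique F G s : thm_props F -> thm_props G -> -1 < s ->
  F s = G s.
Proof.
move=> HF HG s1; have [Fp _ _ Fr] := HF; have [Gp _ _ Gr] := HG.
have pos n t : 0 < t <= n.+1%:R -> F t = G t.
  elim: n t => [|n ih] t; first exact: thm_props_unique01.
  move=> /andP[t0 tn]; have [t1|t1] := leP t 1.
    by apply: thm_props_unique01 => //; rewrite t0.
  have u1 : -1 < t - 1 by rewrite ltrBrDr addNr.
  have tn1 : -1 < t by rewrite (lt_trans (ltrN10 R)).
  rewrite -[t](subrK 1); apply: sub_inv_inj; rewrite ?subrK ?Fp ?Gp//.
  have := Fr _ u1; have := Gr _ u1; rewrite subrK => <- <-.
  by rewrite ih// subr_gt0 t1 lerBlDr natr1.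
have s0 : 0 < s + 1 by rewrite -ltrBlDr sub0r.
have h : F (s + 1) = G (s + 1).
  apply: (pos (Num.bound (s + 1))); rewrite s0/=.
  rewrite (@le_trans _ _ (Num.bound (s + 1))%:R) ?ler_nat//.
  by rewrite ltW// archi_boundP// ltW.
by apply: invr_inj; rewrite -[LHS]div1r -[RHS]div1r Fr// Gr// h.
Qed.
End uniqueness.

(** * The functional equation of the Mellin transform *)

Section integral_is.
Set Implicit Arguments.
Variables (R : realType) (mu : probability R R) (D : set R).
Hypothesis mD : measurable D.
Implicit Types (f g : R -> R) (c v w : R).

(** Integrability is bundled with the value so that signed integrands can be combined linearly
    without side conditions. *)
Definition integral_is (f : R -> R) (v : R) : Prop :=
  mu.-integrable D (EFin \o f) /\ (\int[mu]_(t in D) (f t)%:E)%E = v%:E.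

Lemma integral_is_ext f g v w : {in D, f =1 g} -> v = w ->
  integral_is f v -> integral_is g w.
Proof.
move=> fg -> [If Ef]; split.
  by apply: eq_integrable If => // t tD /=; rewrite fg.
by rewrite -Ef; apply: eq_integral => t tD; rewrite fg.
Qed.

Lemma integral_isZ c f v : integral_is f v -> integral_is (fun t => c * f t) (c * v).
Proof.
move=> [If Ef]; split.
  by have := @integrableZl _ _ _ mu D mD c _ If.
by under eq_integral do rewrite EFinM; rewrite integralZl// Ef.
Qed.

Lemma integral_isD f g v w : integral_is f v -> integral_is g w ->
  integral_is (fun t => f t + g t) (v + w).
Proof.
move=> [If Ef] [Ig Eg]; split.
  by have := @integrableD _ _ _ mu D mD _ _ If Ig.
by under eq_integral do rewrite EFinD; rewrite integralD// Ef Eg.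
Qed.

Lemma integral_is_sum n (f : nat -> R -> R) (v : nat -> R) :
  (forall k, integral_is (f k) (v k)) ->
  integral_is (fun t => \sum_(k < n) f k t) (\sum_(k < n) v k).
Proof.
move=> H.
have e : (fun t => (\sum_(k < n) f k t)%:E) =
    (fun t => \sum_(k < n) (EFin \o f k) t)%E.
  by apply/funext => t; rewrite sumEFin.
split.
  rewrite /comp e; apply: integrable_sum => // k _; exact: (H k).1.
transitivity (\int[mu]_(t in D) (\sum_(k < n) (EFin \o f k) t))%E.
  by apply: eq_integral => t _; rewrite sumEFin.
rewrite (integral_sum mD (fun k : 'I_n => (H k).1)) -sumEFin.
by apply: eq_bigr => k _; rewrite (H k).2.
Qed.

Lemma integral_is_le f g v w : integral_is f v -> integral_is g w ->
  (forall t, D t -> f t <= g t) -> v <= w.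
Proof.
move=> [If Ef] [Ig Eg] fg; rewrite -lee_fin -Ef -Eg.
by apply: le_integral => // t /set_mem tD; rewrite lee_fin fg.
Qed.

Lemma ge0_integral_is f v : measurable_fun D f -> (forall t, D t -> 0 <= f t) ->
  (\int[mu]_(t in D) (f t)%:E)%E = v%:E -> integral_is f v.
Proof.
move=> mf f0 E; split => //; apply/integrableP; split.
  exact/measurable_EFinP.
rewrite (_ : (\int[mu]_(t in D) _)%E = v%:E) ?ltry// -E.
by apply: eq_integral => t /set_mem tD; rewrite /= ger0_norm ?f0.
Qed.
Unset Implicit Arguments.
End integral_is.

(** * Polynomial kernels on the unit square *)

Section kernel.
Variable R : realType.
Implicit Types (p : {poly R}) (t u : R).

(** In this expansion [t^k] comes with [1 + u + .. + u^k]; their moments are [m_k] and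
    [m_0 + .. + m_k], whose product is 1. *)
Lemma horner_kernel p t u : u != 1 ->
  (p.[t] - u * p.[t * u]) / (1 - u) =
  \sum_(k < size p) p`_k * (\sum_(i < k.+1) u ^+ i) * t ^+ k.
Proof.
move=> u1; have u1' : 1 - u != 0 by rewrite subr_eq0 eq_sym.
rewrite !horner_coef mulr_sumr -sumrB mulr_suml; apply: eq_bigr => k _.
have -> : \sum_(i < k.+1) u ^+ i = (1 - u ^+ k.+1) / (1 - u).
  by apply: (mulIf u1'); rewrite divfK// -[RHS]opprB subrX1 -mulNr opprB mulrC.
by rewrite exprMn exprS; field.
Qed.

(** The polynomial [x^n (1 - (1-x)^j) / x], with the division carried out as a geometric sum. *)
Definition geo_poly (n j : nat) : {poly R} :=
  'X^n * \sum_(i < j) (1 - 'X) ^+ i.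

Lemma horner_geo_poly n j t : t * (geo_poly n j).[t] = t ^+ n * (1 - (1 - t) ^+ j).
Proof.
rewrite /geo_poly hornerM hornerXn mulrCA; congr (_ * _).
rewrite -[RHS]opprB subrX1 -mulNr opprB subKr horner_sum; congr (_ * _).
by apply: eq_bigr => i _; rewrite horner_exp !hornerE.
Qed.

Lemma geo_kernel_ge0 n j t u : 0 < t <= 1 -> 0 <= u < 1 ->
  0 <= ((geo_poly n j).[t] - u * (geo_poly n j).[t * u]) / (1 - u).
Proof.
move=> /andP[t0 t1] /andP[u0 u1].
have tu : t * u <= t by rewrite ger_pMr// ltW.
have tu0 : 0 <= t * u by rewrite mulr_ge0// ltW.
rewrite divr_ge0// ?subr_ge0 ?(ltW u1)// -(ler_pM2l t0) [leLHS]mulrA.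
rewrite !horner_geo_poly ler_pM//.
- exact: exprn_ge0.
- by rewrite subr_ge0 exprn_ile1// ?subr_ge0 ?gerBl// (le_trans tu).
- by rewrite lerXn2r// ?nnegrE// ltW.
- by rewrite lerB// lerXn2r// ?nnegrE ?subr_ge0 ?lerB// (le_trans tu).
Qed.
End kernel.

(** * Splitting off the endpoints of the unit interval *)

Section split_endpoint.
Variables (R : realType) (mu : probability R R).

Local Notation I := (`[0%R, 1%R]%classic : set R).
Local Notation T := (`]0%R, 1%R]%classic : set R).
Local Notation U := (`[0%R, 1%R[%classic : set R).

Lemma ge0_integral_set1 (f : R -> R) (x : R) : 0 <= f x ->
  (\int[mu]_(t in [set x]) (f t)%:E = (f x * fine (mu [set x]))%:E)%E.
Proof.
move=> f0; rewrite (eq_integral (cst (f x)%:E)); last first.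
  by move=> t /set_mem ->.
by rewrite integral_cst// EFinM fineK// fin_num_measure.
Qed.

(** The variable [t] will range over []0, 1]] and [u] over [[0, 1[], away from the singularities of
    [t^s] and of [1/(1-u)]. This lemma and the next record what each restriction loses. *)
Lemma ge0_integral_cc_oc (f : R -> R) : measurable_fun setT f ->
  (forall t, 0 <= t <= 1 -> 0 <= f t) ->
  (\int[mu]_(t in I) (f t)%:E =
   (f 0 * fine (mu [set 0%R]))%:E + \int[mu]_(t in T) (f t)%:E)%E.
Proof.
move=> mf f0; have -> : `[0, 1]%classic = [set 0] `|` T :> set R.
  by rewrite (setU1itv false)// bnd_simp.
rewrite ge0_integral_setU//.
- by rewrite ge0_integral_set1// f0// lexx ler01.
- exact/measurable_EFinP/measurable_funTS.
- move=> x; rewrite /= in_itv/= lee_fin => -[->|/andP[x0 x1]]; apply: f0.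
    by rewrite lexx ler01.
  by rewrite (ltW x0).
- by apply/disj_setPS => x /= []->; rewrite in_itv/= ltxx.
Qed.

Lemma ge0_integral_cc_co (f : R -> R) : measurable_fun setT f ->
  (forall t, 0 <= t <= 1 -> 0 <= f t) ->
  (\int[mu]_(t in I) (f t)%:E =
   \int[mu]_(t in U) (f t)%:E + (f 1 * fine (mu [set 1%R]))%:E)%E.
Proof.
move=> mf f0; have -> : `[0, 1]%classic = U `|` [set 1] :> set R.
  by rewrite (setUitv1 true)// bnd_simp.
rewrite ge0_integral_setU//.
- by rewrite ge0_integral_set1// f0// lexx ler01.
- exact/measurable_EFinP/measurable_funTS.
- move=> x; rewrite /= in_itv/= lee_fin => -[/andP[x0 x1]|->]; apply: f0.
    by rewrite x0 (ltW x1).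
  by rewrite lexx ler01.
- by apply/disj_setPS => x /= [] /[swap] ->; rewrite in_itv/= ltxx andbF.
Qed.
End split_endpoint.

(** * The moment measure and its Mellin transform *)

Section moments.
Variables (R : realType) (m : nat -> R) (mu : probability R R).
Hypothesis m0 : m 0%N = 1.
Hypothesis m_gt0 : forall n, 0 < m n.
Hypothesis m_rec : forall n, (0 < n)%N -> (\sum_(i < n.+1) m i) * m n = 1.
Hypothesis mu_m : forall n : nat,
  (\int[mu]_(t in `[0%R, 1%R]%classic) (t ^+ n)%:E = (m n)%:E)%E.

Local Notation I := (`[0%R, 1%R]%classic : set R).
Local Notation T := (`]0%R, 1%R]%classic : set R).
Local Notation U := (`[0%R, 1%R[%classic : set R).

Let mT : measurable T. Proof. exact: measurable_itv. Qed.
Let mU : measurable U. Proof. exact: measurable_itv. Qed.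

Lemma sum_m n : \sum_(i < n.+1) m i = (m n)^-1.
Proof.
case: n => [|n]; first by rewrite big_ord_recl big_ord0 m0 addr0 invr1.
apply: (mulIf (lt0r_neq0 (m_gt0 n.+1))).
by rewrite m_rec// mulVf// lt0r_neq0.
Qed.

(** By [sum_m], the reciprocals [y_n = 1 / m_n] satisfy [y_n = y_(n+1) - 1 / y_(n+1)], so
    [inv_sqr_step] applies. *)
Lemma m_sqr_le n : n.+1%:R * m n ^+ 2 <= 1.
Proof.
have h : n.+1%:R <= (m n)^-1 ^+ 2.
  elim: n => [|n ih]; first by rewrite m0 invr1 expr1n.
  rewrite -natr1 (@le_trans _ _ ((m n)^-1 ^+ 2 + 1)) ?lerD2r//.
  have e : (m n.+1)^-1 = (m n)^-1 + m n.+1 by rewrite -!sum_m [LHS]big_ord_recr.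
  by apply: inv_sqr_step; rewrite ?invr_gt0// invrK e addrK.
rewrite -[leRHS](@mulVf _ (m n ^+ 2)) ?expf_neq0 ?lt0r_neq0//.
by rewrite ler_wpM2r ?sqr_ge0// -exprVn.
Qed.

Lemma powers_ge0 n (t : R) : 0 <= t <= 1 -> 0 <= t ^+ n.
Proof. by move=> /andP[t0 _]; rewrite exprn_ge0. Qed.

(** An atom at 1 adds its full mass to every moment, while [m_n] tends to 0 by [m_sqr_le]. *)
Lemma mass_at1 : fine (mu [set 1]) = 0.
Proof.
set v := fine _.
have v0 : 0 <= v by rewrite fine_ge0.
have vm n : v <= m n.
  rewrite -lee_fin -mu_m ge0_integral_cc_co//; last exact: powers_ge0.
  rewrite expr1n mul1r leeDr//; apply: integral_ge0 => t.
  by rewrite /= in_itv/= lee_fin => /andP[t0 _]; rewrite exprn_ge0.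
apply/eqP; rewrite -sqrf_eq0 eq_le sqr_ge0 andbT; apply: le0_bounded_multiples => n.
apply: le_trans (m_sqr_le n); rewrite ler_wpM2l// lerXn2r ?nnegrE ?vm//.
exact/ltW.
Qed.

Lemma moments_U n : integral_is mu U (fun u => u ^+ n) (m n).
Proof.
apply: ge0_integral_is => //.
- by move=> t; rewrite /= in_itv/= => /andP[t0 _]; rewrite exprn_ge0.
- rewrite -mu_m ge0_integral_cc_co//; last exact: powers_ge0.
  by rewrite mass_at1 mulr0 adde0.
Qed.

(** A mass at 0 enters only the zeroth moment, as [0^0 = 1]. It is carried along until [mass_at0]
    shows that it vanishes. *)
Lemma moments_T0 n : integral_is mu T (fun t => t ^+ n)
  (m n - (n == 0)%:R * fine (mu [set 0])).
Proof.
apply: ge0_integral_is => //.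
- by move=> t; rewrite /= in_itv/= => /andP[t0 _]; rewrite exprn_ge0// ltW.
- rewrite EFinB -mu_m ge0_integral_cc_oc//; last exact: powers_ge0.
  by rewrite expr0n [X in _ = (X - _)%E]addeC addeK.
Qed.

(* [int_U int_T (p(t) - u p(tu))/(1-u)] sends [X^k] to [m_k (m_0 + .. + m_k)],
   i.e. to 1, up to a defect from the mass at 0 that affects only [k = 0]. *)
Definition inner_moments (p : {poly R}) (u : R) : R :=
  \sum_(k < size p) p`_k * (\sum_(i < k.+1) u ^+ i) *
    (m k - (k == 0 :> nat)%:R * fine (mu [set 0])).

Lemma inner_momentsP p u : 0 <= u < 1 ->
  integral_is mu T (fun t => (p.[t] - u * p.[t * u]) / (1 - u)) (inner_moments p u).
Proof.
move=> /andP[u0 u1].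
apply: (@integral_is_ext _ _ _ mT (fun t => \sum_(k < size p)
   (p`_k * (\sum_(i < k.+1) u ^+ i)) * t ^+ k)) => //.
  by move=> t _ /=; rewrite horner_kernel// lt_eqF.
apply: (@integral_is_sum _ _ _ mT (size p) (fun k t =>
   (p`_k * (\sum_(i < k.+1) u ^+ i)) * t ^+ k) (fun k =>
   p`_k * (\sum_(i < k.+1) u ^+ i) *
    (m k - (k == 0)%:R * fine (mu [set 0])))) => k.
by apply: integral_isZ => //; exact: moments_T0.
Qed.

Lemma outer_momentsP p :
  integral_is mu U (inner_moments p) (p.[1] - p.[0] * fine (mu [set 0])).
Proof.
pose b k := m k - (k == 0 :> nat)%:R * fine (mu [set 0]).
apply: (@integral_is_ext _ _ _ mU (fun u => \sum_(k < size p)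
   (p`_k * b k) * (\sum_(i < k.+1) u ^+ i)) _ (\sum_(k < size p)
   (p`_k * b k) * (\sum_(i < k.+1) m i))).
- by move=> u _; rewrite /inner_moments; apply: eq_bigr => k _; rewrite mulrAC.
- rewrite horner_coef0 horner_coef.
  have -> : p`_0 = \sum_(k < size p) p`_k * (k == 0 :> nat)%:R.
    case: (size p) (@nth_default _ (0 : R) p) => [|n] H.
      by rewrite big_ord0 H.
    by rewrite big_ord_recl/= mulr1 big1 ?addr0// => i _; rewrite mulr0.
  rewrite mulr_suml -sumrB; apply: eq_bigr => k _.
  rewrite sum_m /b expr1n mulr1; case: (nat_of_ord k) => [|i] /=.
    by rewrite m0 invr1; ring.
  by rewrite mulr0 !mul0r !subr0 mulfK// lt0r_neq0.
apply: (@integral_is_sum _ _ _ mU (size p) (fun k u =>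
   (p`_k * b k) * (\sum_(i < k.+1) u ^+ i)) (fun k =>
   (p`_k * b k) * (\sum_(i < k.+1) m i))) => k.
apply: integral_isZ => //.
exact: (@integral_is_sum _ _ _ mU k.+1 (fun i u => u ^+ i) m moments_U).
Qed.

Lemma horner_geo_poly1 n j : (geo_poly R n j.+1).[1] = 1.
Proof.
by have := horner_geo_poly R n j.+1 1; rewrite mul1r expr1n subrr expr0n subr0 mul1r.
Qed.

Lemma inner_moments_ge0 n j u : 0 <= u < 1 -> 0 <= inner_moments (geo_poly R n j) u.
Proof.
move=> u01; have H := inner_momentsP (geo_poly R n j) u u01.
rewrite -lee_fin -H.2; apply: integral_ge0 => t.
by rewrite /= in_itv/= lee_fin => t01; exact: geo_kernel_ge0.
Qed.

(** For [p = geo_poly R 0 (n+1)] one has [p(1) = 1] and [p(0) = n+1], so the nonnegative double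
    integral equals 1 minus [n+1] times the mass. *)
Lemma mass_at0 : fine (mu [set 0]) = 0.
Proof.
apply/eqP; rewrite eq_le fine_ge0// andbT; apply: le0_bounded_multiples => n.
have := outer_momentsP (geo_poly R 0 n.+1); rewrite horner_geo_poly1.
have -> : (geo_poly R 0 n.+1).[0] = n.+1%:R.
  rewrite /geo_poly expr0 mul1r horner_sum.
  under eq_bigr do rewrite horner_exp !hornerE subr0 expr1n.
  by rewrite sumr_const card_ord.
move=> [_ E]; rewrite -subr_ge0 -lee_fin -E; apply: integral_ge0 => u.
by rewrite /= in_itv/= lee_fin; exact: inner_moments_ge0.
Qed.

(* Where [u = 1] this is 0 by the convention for division, so it is only
   integrated over [0,1[. *)
Definition slope (s u : R) : R := (1 - u `^ (s + 1)) / (1 - u).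

Lemma slope_ge0 s u : -1 < s -> 0 <= u < 1 -> 0 <= slope s u.
Proof.
move=> s1 /andP[u0 u1]; rewrite divr_ge0// subr_ge0 ?(ltW u1)//.
rewrite -[leRHS](congr1 (@^~ (s + 1)) (powR1 R)) ge0_ler_powR ?nnegrE// ?(ltW u1)//.
by rewrite -lerBlDr sub0r ltW.
Qed.

(** The binomial series gives [x^(s+1)] as a combination of the functions [x p_j(x)], where
    [p_j = geo_poly R n (j+1)]. It is used at [x = t] and [x = tu], and the difference is divided by
    [t (1-u)]. *)
Lemma kernel_series s n a t u : 0 < a -> a <= 1 -> s + 1 = n%:R + a ->
  0 < t <= 1 -> 0 <= u < 1 ->
  (\sum_(j < N) pow_coef R a j *
     (((geo_poly R n j.+1).[t] - u * (geo_poly R n j.+1).[t * u]) / (1 - u)))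
  @[N --> \oo] --> t `^ s * slope s u.
Proof.
move=> a0 a1 sE /andP[t0 t1] /andP[u0 u1].
have u1' : 1 - u != 0 by rewrite subr_eq0 eq_sym lt_eqF.
have s1 : 0 < s + 1 by rewrite sE ltr_wpDl.
have ser x : 0 <= x <= 1 ->
    x ^+ n * (\sum_(j < N) pow_coef R a j * (1 - (1 - x) ^+ j.+1)) @[N --> \oo]
    --> x `^ (s + 1).
  (* The point [x = 0] arises as [tu] with [u = 0]; every term of the series vanishes there, and so
     does [0^(s+1)] because [s + 1 > 0]. *)
  move=> /andP[]; rewrite le_eqVlt => /predU1P[<- _|x0 x1].
    rewrite powR0 ?lt0r_neq0//; apply: cvg_near_cst; apply: nearW => N.
    by rewrite big1 ?mulr0// => j _; rewrite subr0 expr1n subrr mulr0.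
  have -> : x `^ (s + 1) = x ^+ n * x `^ a.
    by rewrite sE powRD ?lt0r_neq0 ?implybT// powR_mulrn// ltW.
  by apply: cvgMr; apply: pow_series_cvg; rewrite ?x0.
have -> : t `^ s * slope s u = (t `^ (s + 1) - (t * u) `^ (s + 1)) * (t * (1 - u))^-1.
  rewrite powRM ?(ltW t0)// -(mulr_powRB1 (ltW t0) s1) addrK /slope.
  by field; rewrite u1' lt0r_neq0.
have -> : (fun N => \sum_(j < N) pow_coef R a j *
     (((geo_poly R n j.+1).[t] - u * (geo_poly R n j.+1).[t * u]) / (1 - u))) =
  (fun N => (t ^+ n * (\sum_(j < N) pow_coef R a j * (1 - (1 - t) ^+ j.+1)) -
     (t * u) ^+ n * (\sum_(j < N) pow_coef R a j * (1 - (1 - t * u) ^+ j.+1)))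
     * (t * (1 - u))^-1).
  apply/funext => N; rewrite !mulr_sumr -sumrB mulr_suml.
  apply: eq_bigr => j _; rewrite ![_ ^+ n * (pow_coef _ _ _ * _)]mulrCA.
  rewrite -!horner_geo_poly; field; by rewrite u1' lt0r_neq0.
apply: cvgMl; apply: cvgB; apply: ser.
  by rewrite (ltW t0).
by rewrite mulr_ge0 ?(ltW t0)//= mulr_ile1 ?(ltW t0) ?(ltW u1).
Qed.

Lemma measurable_slope s : measurable_fun U (slope s).
Proof.
(* On [[0, 1[] the inverse of [1 - u] is the real power [-1], which is measurable on the whole
   line. *)
apply: (@eq_measurable_fun _ _ _ _ _ (fun u => (1 - u `^ (s + 1)) * (1 - u) `^ (-1))).
  move=> u /set_mem; rewrite /= in_itv/= => /andP[_ u1].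
  by rewrite powR_inv1// subr_ge0 ltW.
apply: measurable_funTS; apply: measurable_funM.
  by apply: measurable_funB => //; exact: measurable_powR.
have H : measurable_fun setT (fun u : R => 1 - u) by exact: measurable_funB.
exact: (measurableT_comp (measurable_powR (-1)) H).
Qed.

(** Both integrals are exchanged with the nonnegative series of [kernel_series]. Term [j]
    contributes [pow_coef R a j], and these coefficients sum to 1. *)
Lemma iterated_integral s : -1 < s ->
  (\int[mu]_(u in U) \int[mu]_(t in T) (t `^ s * slope s u)%:E = 1)%E.
Proof.
move=> s1; have [|n [a [a0 a1 sE]]] := split_exponent R (s + 1).
  by rewrite -ltrBlDr sub0r.
pose K j t u := ((geo_poly R n j.+1).[t] - u * (geo_poly R n j.+1).[t * u]) / (1 - u).
have d0 := pow_coef_ge0 R a a0 a1.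
have KP j u : 0 <= u < 1 -> integral_is mu T (fun t => pow_coef R a j * K j t u)
    (pow_coef R a j * inner_moments (geo_poly R n j.+1) u).
  by move=> u01; apply: integral_isZ => //; exact: inner_momentsP.
have QP j : integral_is mu U
    (fun u => pow_coef R a j * inner_moments (geo_poly R n j.+1) u) (pow_coef R a j).
  apply: (@integral_is_ext _ _ _ mU (fun u => pow_coef R a j *
     inner_moments (geo_poly R n j.+1) u) _ (pow_coef R a j * 1)) => //.
    by rewrite mulr1.
  apply: integral_isZ => //; have := outer_momentsP (geo_poly R n j.+1).
  by rewrite mass_at0 mulr0 subr0 horner_geo_poly1.
transitivity (\int[mu]_(u in U) \sum_(j <oo)
    (pow_coef R a j * inner_moments (geo_poly R n j.+1) u)%:E)%E.
  apply: eq_integral => u /set_mem; rewrite /= in_itv/= => u01.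
  transitivity (\int[mu]_(t in T) \sum_(j <oo) (pow_coef R a j * K j t u)%:E)%E.
    apply: eq_integral => t /set_mem; rewrite /= in_itv/= => t01.
    by rewrite (nneseries_EFin _ _ _ (kernel_series _ _ _ _ _ a0 a1 sE t01 u01)).
  rewrite integral_nneseries//.
  - by apply: eq_eseriesr => j _; exact: (KP j u u01).2.
  - by move=> j; exact: measurable_int (KP j u u01).1.
  - move=> j t; rewrite /= in_itv/= lee_fin => t01.
    by rewrite mulr_ge0// geo_kernel_ge0.
rewrite integral_nneseries//.
- rewrite (eq_eseriesr (g := fun j => (pow_coef R a j)%:E)).
    by apply: nneseries_EFin; exact: pow_coef_sum_cvg.
  by move=> j _; exact: (QP j).2.
- by move=> j; exact: measurable_int (QP j).1.
- move=> j t; rewrite /= in_itv/= lee_fin => t01.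
  by rewrite mulr_ge0// inner_moments_ge0.
Qed.

Lemma Mellin_slope s : -1 < s ->
  (\int[mu]_(t in T) (t `^ s)%:E * \int[mu]_(u in U) (slope s u)%:E = 1)%E.
Proof.
move=> s1; rewrite -(iterated_integral s s1) muleC -ge0_integralZr//.
- apply: eq_integral => u /set_mem; rewrite /= in_itv/= => u01.
  symmetry; transitivity (\int[mu]_(t in T) ((slope s u)%:E * (t `^ s)%:E))%E.
    by apply: eq_integral => t _; rewrite mulrC EFinM.
  rewrite ge0_integralZl_EFin ?slope_ge0//.
  + by move=> t _; rewrite lee_fin powR_ge0.
  + by apply/measurable_EFinP/measurable_funTS; exact: measurable_powR.
- apply/measurable_EFinP; exact: measurable_slope.
- by move=> u; rewrite /= in_itv/= lee_fin; exact: slope_ge0.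
- by apply: integral_ge0 => t _; rewrite lee_fin powR_ge0.
Qed.

Let F0 (s : R) : R := Rintegral mu T (fun t => t `^ s).

Lemma Mellin_finite s : -1 < s ->
  [/\ 0 < F0 s, integral_is mu T (fun t => t `^ s) (F0 s)
    & integral_is mu U (slope s) (F0 s)^-1].
Proof.
move=> s1; have [||r r0 [Jr Hr]] := mule_eq1 _ _ _ _ _ (Mellin_slope s s1).
- by apply: integral_ge0 => t _; rewrite lee_fin powR_ge0.
- by apply: integral_ge0 => u; rewrite /= in_itv/= lee_fin; exact: slope_ge0.
have -> : F0 s = r by rewrite /F0 /Rintegral Jr.
split => //; apply: ge0_integral_is => //.
- by apply: measurable_funTS; exact: measurable_powR.
- by move=> t _; exact: powR_ge0.
- exact: measurable_slope.
- by move=> u; rewrite /= in_itv/=; exact: slope_ge0.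
Qed.

(** With no atom at 0 or 1, integrating over []0, 1]] or over [[0, 1[] gives the same value. *)
Lemma integral_U_powR s : -1 < s ->
  integral_is mu U (fun t => t `^ (s + 1)) (F0 (s + 1)).
Proof.
move=> s1; have s2 : -1 < s + 1 by rewrite ltr_wpDr.
have [_ [_ E] _] := Mellin_finite (s + 1) s2.
apply: ge0_integral_is => //.
- by apply: measurable_funTS; exact: measurable_powR.
- by move=> t _; exact: powR_ge0.
- rewrite -E -[LHS]adde0 -[RHS]add0e.
  have mp : measurable_fun setT (fun t : R => t `^ (s + 1)) by exact: measurable_powR.
  have := ge0_integral_cc_co R mu _ mp (fun t _ => powR_ge0 t _).
  rewrite (ge0_integral_cc_oc R mu _ mp (fun t _ => powR_ge0 t _)).
  by rewrite mass_at0 mass_at1 !mulr0 => ->.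
Qed.

Lemma slopeD1 s u : -1 < s -> 0 <= u < 1 -> slope (s + 1) u = slope s u + u `^ (s + 1).
Proof.
move=> s1 /andP[u0 u1]; have u1' : 1 - u != 0 by rewrite subr_eq0 eq_sym lt_eqF.
rewrite /slope -(mulr_powRB1 u0 (p := s + 1 + 1)) ?addrK; first by field.
by rewrite addr_gt0// -ltrBlDr sub0r.
Qed.

Lemma Mellin_rec s : -1 < s -> 1 / F0 s = 1 / F0 (s + 1) - F0 (s + 1).
Proof.
move=> s1; have s2 : -1 < s + 1 by rewrite ltr_wpDr.
have [_ _ Hs] := Mellin_finite s s1; have [_ _ Hs1] := Mellin_finite _ s2.
have := integral_isD mU Hs (integral_U_powR s s1) => -[_ E].
rewrite !div1r; apply/eqP; rewrite eq_sym subr_eq -eqe -Hs1.2 -E.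
apply/eqP/eq_integral => u /set_mem; rewrite /= in_itv/= => u01.
by rewrite slopeD1.
Qed.

Lemma Mellin0 : F0 0 = 1.
Proof.
have := (moments_T0 0).2; rewrite mass_at0 mulr0 subr0 m0 => E.
rewrite /F0 /Rintegral (_ : (\int[mu]_(x in T) (x `^ 0)%:E)%E = 1%:E)// -E.
by apply: eq_integral => t _; rewrite powRr0 expr0.
Qed.

Lemma Mellin_log_convex : log_convex_on `]-1, +oo[%classic F0.
Proof.
move=> x y th; rewrite /= !in_itv/= !andbT => x1 y1 th01.
have /andP[th0 th1] := th01.
set z := _ + th * y.
have z1 : -1 < z.
  have x1' : 0 < x + 1 by rewrite -ltrBlDr sub0r.
  have y1' : 0 < y + 1 by rewrite -ltrBlDr sub0r.
  have h0 : 0 < (1 - th) * (x + 1) + th * (y + 1).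
    have [->|t0] := eqVneq th 0; first by rewrite subr0 mul0r addr0 mul1r.
    by rewrite ltr_wpDl ?mulr_ge0 ?subr_ge0 ?(ltW x1')// mulr_gt0// lt0r t0.
  by rewrite -subr_gt0 (_ : z - -1 = (1 - th) * (x + 1) + th * (y + 1))// /z; ring.
have [Ax Ix _] := Mellin_finite x x1; have [Ay Iy _] := Mellin_finite y y1.
have [Az Iz _] := Mellin_finite z z1.
move: (F0 x) (F0 y) (F0 z) Ax Ay Az Ix Iy Iz => A B C A0 B0 C0 Ix Iy Iz.
set L := _ + th * ln B; rewrite -[leRHS]expRK ler_ln ?posrE ?expR_gt0//.
have J := integral_isD mT (integral_isZ mT (expR L * (1 - th) / A) Ix)
  (integral_isZ mT (expR L * th / B) Iy).
(* The weights are chosen so that the integral of the majorant in [powR_log_convex] is exactly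
   [expR L]. *)
rewrite (_ : expR L = expR L * (1 - th) / A * A + expR L * th / B * B); last first.
  by rewrite !divfK ?lt0r_neq0// -mulrDr subrK mulr1.
apply: (integral_is_le mT Iz J) => t; rewrite /= in_itv/= => /andP[t0 _].
exact: powR_log_convex.
Qed.

Lemma Mellin_thm_props : thm_props F0.
Proof.
split; [|exact: Mellin0|exact: Mellin_log_convex|exact: Mellin_rec].
by move=> s /Mellin_finite[].
Qed.
End moments.

Theorem theorem1p3 (R : realType) (m : nat -> R) (mu : probability R R) :
  m 0%N = 1 ->
  (forall n : nat, 0 < m n) ->
  (forall n : nat, (0 < n)%N -> (\sum_(i < n.+1) m i) * m n = 1) ->
  mu `[0%R, 1%R]%classic = 1%E ->
  (forall n : nat, (\int[mu]_(t in `[0%R, 1%R]%classic) (t ^+ n)%:E = (m n)%:E)%E) ->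
  let F0 := fun s : R => Rintegral mu `]0, 1]%classic (fun t => t `^ s) in
  [/\ (forall s : R, -1 < s -> mu.-integrable `]0, 1]%classic (fun t => (t `^ s)%:E)),
      thm_props F0 &
      (forall F : R -> R, thm_props F -> forall s : R, -1 < s -> F s = F0 s)].
Proof.
move=> m0 m_gt0 m_rec _ mu_m F0.
have F0P : thm_props F0 by apply: (Mellin_thm_props R m mu).
split => //.
- by move=> s s1; have [_ []] := Mellin_finite R m mu m0 m_gt0 m_rec mu_m s s1.
- by move=> F FP s s1; exact: thm_props_unique.
Qed.
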